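(* We have $$1+\sum_{n\ge1}\frac{x^n}{n!}\sum_{\pi\in\mathfrak{S}_n(\underline{123})}t^{\mathrm{des}(\pi)+1}=\frac{e^{tx/2}\sqrt{t-4}}{\sqrt{t-4}\,\cosh\!\left(\frac{x}{2}\sqrt{t^2-4t}\right)-\sqrt{t}\,\sinh\!\left(\frac{x}{2}\sqrt{t^2-4t}\right)},$$ equivalently, $$\sum_{n\ge0}\frac{x^n}{n!}\sum_{\pi\in\mathfrak{S}_n(\underline{123})}t^{\mathrm{des}(\pi)}=\frac{t^{-1}e^{tx/2}\sqrt{t-4}}{\sqrt{t-4}\,\cosh\!\left(\frac{x}{2}\sqrt{t^2-4t}\right)-\sqrt{t}\,\sinh\!\left(\frac{x}{2}\sqrt{t^2-4t}\right)}-\frac{1}{t}+1 .$$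
   Context: $\mathfrak{S}_n$ is the set of permutations of $\{1,\ldots,n\}$ in one-line notation ($\mathfrak{S}_0$ contains only the empty permutation, with $0$ descents), and $\mathrm{des}(\pi)=|\{i\in[n-1]:\pi_i>\pi_{i+1}\}|$. $\mathfrak{S}_n(\underline{123})$ is the set of $\pi\in\mathfrak{S}_n$ with no index $i$ such that $\pi_i<\pi_{i+1}<\pi_{i+2}$. The identities are between formal power series in $x$, with square roots taken in an extension of $\mathbb{Q}(t)$ and chosen so that $\sqrt{t^2-4t}=\sqrt{t}\,\sqrt{t-4}$. *)

(* Defs.v *)
From HB Require Import structures.
From mathcomp Require Import all_boot all_order all_algebra all_fingroup.
From mathcomp Require Import boolp.

Set Implicit Arguments.
Unset Strict Implicit.
Unset Printing Implicit Defensive.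

Import GRing.Theory.
Local Open Scope ring_scope.

(* Permutations of 'I_n are the permutations of {1, ..., n} shifted down by
   one; descents and consecutive patterns depend only on the relative order. *)

Definition descents (n : nat) (p : 'S_n) : {set 'I_n} :=
  [set i : 'I_n | [exists j : 'I_n, (j == i.+1 :> nat) && (p j < p i)%N]].

Definition des (n : nat) (p : 'S_n) : nat := #|descents p|.

Definition avoids_consecutive_123 (n : nat) (p : 'S_n) : bool :=
  [forall i : 'I_n, forall j : 'I_n, forall k : 'I_n,
     (j == i.+1 :> nat) && (k == i.+2 :> nat) ==>
       ~~ ((p i < p j)%N && (p j < p k)%N)].

(* The ring K[[x]] of formal power series over a field K. *)

Record fps (K : fieldType) := Fps { fpscoef : nat -> K }.

Section FpsRing.
Variable K : fieldType.
Implicit Types f g h : fps K.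

Lemma fpsP f g : fpscoef f =1 fpscoef g <-> f = g.
Proof. by split=> [|-> //]; case: f g => f [g] /= /funext ->. Qed.

HB.instance Definition _ := gen_eqMixin (fps K).
HB.instance Definition _ := gen_choiceMixin (fps K).

Definition fps_const (c : K) : fps K := Fps (fun n => if n is 0 then c else 0).
Definition fps_zero : fps K := Fps (fun=> 0).
Definition fps_opp f : fps K := Fps (fun n => - fpscoef f n).
Definition fps_add f g : fps K := Fps (fun n => fpscoef f n + fpscoef g n).
Definition fps_mul f g : fps K :=
  Fps (fun n => \sum_(i < n.+1) fpscoef f i * fpscoef g (n - i)%N).

Fact fps_addA : associative fps_add.
Proof. by move=> f g h; apply/fpsP => n /=; rewrite addrA. Qed.
Fact fps_addC : commutative fps_add.
Proof. by move=> f g; apply/fpsP => n /=; rewrite addrC. Qed.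
Fact fps_add0 : left_id fps_zero fps_add.
Proof. by move=> f; apply/fpsP => n /=; rewrite add0r. Qed.
Fact fps_addN : left_inverse fps_zero fps_opp fps_add.
Proof. by move=> f; apply/fpsP => n /=; rewrite addNr. Qed.

HB.instance Definition _ :=
  GRing.isZmodule.Build (fps K) fps_addA fps_addC fps_add0 fps_addN.

Definition fps_trunc (n : nat) f : {poly K} := \poly_(i < n.+1) fpscoef f i.

Lemma coef_fps_trunc n f i : (i <= n)%N -> (fps_trunc n f)`_i = fpscoef f i.
Proof. by move=> le_in; rewrite coef_poly ltnS le_in. Qed.

Lemma fps_mul_trunc n f g i : (i <= n)%N ->
  fpscoef (fps_mul f g) i = (fps_trunc n f * fps_trunc n g)`_i.
Proof.
move=> le_in; rewrite coefM; apply: eq_bigr => j _.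
by rewrite !coef_fps_trunc // (leq_trans _ le_in) ?leq_subr // -ltnS.
Qed.

Fact fps_mulA : associative fps_mul.
Proof.
move=> f g h; apply/fpsP => n.
transitivity (fps_trunc n f * (fps_trunc n g * fps_trunc n h))`_n.
  rewrite coefM; apply: eq_bigr => i _.
  by rewrite coef_fps_trunc -1?ltnS // (fps_mul_trunc _ _ (leq_subr i n)).
rewrite mulrA coefM; apply: eq_bigr => i _.
by rewrite coef_fps_trunc ?leq_subr // (@fps_mul_trunc n) // -ltnS.
Qed.

Fact fps_mulC : commutative fps_mul.
Proof.
by move=> f g; apply/fpsP => n; rewrite !(@fps_mul_trunc n) // mulrC.
Qed.

Fact fps_mul1 : left_id (fps_const 1) fps_mul.
Proof.
move=> f; apply/fpsP => n /=; rewrite big_ord_recl subn0 mul1r big1 ?addr0 //.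
by move=> i _; rewrite /= mul0r.
Qed.

Fact fps_mulDl : left_distributive fps_mul fps_add.
Proof.
move=> f g h; apply/fpsP => n /=; rewrite -big_split /=.
by apply: eq_bigr => i _; rewrite mulrDl.
Qed.

Fact fps_1neq0 : fps_const 1 != 0 :> fps K.
Proof. by apply/eqP => /fpsP/(_ 0%N)/eqP; rewrite /= oner_eq0. Qed.

HB.instance Definition _ := GRing.Zmodule_isComNzRing.Build (fps K)
  fps_mulA fps_mulC fps_mul1 fps_mulDl fps_1neq0.

(* A power series over a field is invertible iff its constant term is nonzero;
   on other series the inverse is the identity, as for every unitRingType. *)
Definition fps_unit : pred (fps K) := fun f => fpscoef f 0 != 0.

(* The first n coefficients of 1 / f, obtained by solving (1 / f) * f = 1
   degree by degree. *)
Fixpoint fps_invseq f (n : nat) : seq K :=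
  if n is m.+1 then
    let s := fps_invseq f m in
    rcons s (if m == 0%N then (fpscoef f 0)^-1
             else - (\sum_(i < m) s`_i * fpscoef f (m - i)) / fpscoef f 0)
  else [::].

Definition fps_inv f : fps K :=
  if fps_unit f then Fps (fun n => (fps_invseq f n.+1)`_n) else f.

Lemma size_fps_invseq f n : size (fps_invseq f n) = n.
Proof. by elim: n => //= n IHn; rewrite size_rcons IHn. Qed.

Lemma nth_fps_invseq f n i : (i < n)%N ->
  (fps_invseq f n)`_i = (fps_invseq f i.+1)`_i.
Proof.
elim: n => // n IHn; rewrite ltnS leq_eqVlt => /predU1P[-> //|lt_in].
by rewrite -IHn //= nth_rcons size_fps_invseq lt_in.
Qed.

Fact fps_mulV : {in fps_unit, left_inverse 1 fps_inv *%R}.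
Proof.
move=> f f_unit; have f0 : fpscoef f 0 != 0 by [].
rewrite /fps_inv (f0 : fps_unit f).
apply/fpsP => n; rewrite [LHS]/= big_ord_recr /= subnn nth_rcons.
rewrite size_fps_invseq ltnn eqxx.
case: n => [|n] /=; first by rewrite big_ord0 add0r mulVf.
rewrite mulfVK // -/(fps_invseq f n.+1).
apply/eqP; rewrite subr_eq0; apply/eqP; apply: eq_bigr => i _.
by congr (_ * _); rewrite [RHS](nth_fps_invseq f (ltn_ord i)).
Qed.

Fact fps_unitP f g : g * f = 1 -> fps_unit f.
Proof.
move/fpsP/(_ 0%N); rewrite /= big_ord1 subn0 => gf1.
by apply/eqP => f0; move/eqP: gf1; rewrite f0 mulr0 eq_sym oner_eq0.
Qed.

Fact fps_inv_out : {in [predC fps_unit], fps_inv =1 id}.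
Proof.
move=> f /negbTE f_unit; rewrite /fps_inv; case: ifP => // f0.
by rewrite -topredE /= f0 in f_unit.
Qed.

HB.instance Definition _ := GRing.ComNzRing_hasMulInverse.Build (fps K)
  fps_mulV fps_unitP fps_inv_out.

(* The argument a stands for the series a x: fps_exp a is e^{a x}, fps_cosh a is
   cosh(a x), fps_sinh a is sinh(a x). *)
Definition fps_exp (a : K) : fps K := Fps (fun n => a ^+ n / n`!%:R).
Definition fps_cosh (a : K) : fps K :=
  fps_const 2^-1 * (fps_exp a + fps_exp (- a)).
Definition fps_sinh (a : K) : fps K :=
  fps_const 2^-1 * (fps_exp a - fps_exp (- a)).

(* The exponential generating function sum_n a_n x^n / n!. *)
Definition egf (a : nat -> K) : fps K := Fps (fun n => a n / n`!%:R).

End FpsRing.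

(* Main.v *)
Require Import Defs.
From mathcomp Require Import all_boot all_order all_algebra all_fingroup.
From mathcomp Require Import zify ring.

Import GRing.Theory.
Local Open Scope ring_scope.

(* Let a_n be the sum of t^(des p + 1) over the avoiders of size n >= 1, with
   a_0 = 1, and refine it by the last value: T_n(k) over the avoiders of size
   n + 1 with last value k, and D_n(k) over those that moreover do not end with
   an ascent.  Appending a last value k to a permutation gives
     D_{n+1}(k) = t (a_{n+1} - sum_{j<k} T_n(j)),
     T_{n+1}(k) = D_{n+1}(k) + sum_{j<k} D_n(j).
   Let sum_n c_n z^n = 1 / (1 + t z + t z^2).  As summation over j < k sends
   'C(j, m) to 'C(k, m+1), the solution is
     D_n(k) = t sum_j c_j a_{n-j} 'C(k, j),
     T_n(k) = - sum_j c_{j+1} a_{n-j} 'C(k, j),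
   and summing T_n over k says that the exponential generating functions of
   (c_n) and (a_n) are inverse to each other.  Finally c_n is a combination of
   the powers of the roots (- t +- sqrt (t^2 - 4 t)) / 2 of z^2 + t z + t. *)

(** * Appending a last value to a permutation *)

Definition ends_with_ascent {n : nat} (p : 'S_n.+1) : bool :=
  [exists i : 'I_n.+1, (i.+1 == n :> nat) && (p i < p ord_max)%N].

(** [lift_perm ord_max k p] is [p] with the last value [k] appended: the values of [p] from [k]
    upwards move up by one, which keeps their relative order. *)
Lemma ltn_lift_perm_lift (n : nat) (k : 'I_n.+2) (p : 'S_n.+1) (i j : 'I_n.+1) :
  (lift_perm ord_max k p (lift ord_max i) < lift_perm ord_max k p (lift ord_max j))%N
    = (p i < p j)%N.
Proof. by rewrite !lift_perm_lift /= ltnNge leq_bump2 -ltnNge. Qed.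

Lemma ltn_lift_perm_last (n : nat) (k : 'I_n.+2) (p : 'S_n.+1) (i : 'I_n.+1) :
  (lift_perm ord_max k p (lift ord_max i) < lift_perm ord_max k p ord_max)%N
    = (p i < k)%N.
Proof.
by rewrite lift_perm_lift lift_perm_id /= /bump; case: leqP => h; lia.
Qed.

Lemma ltn_last_lift_perm (n : nat) (k : 'I_n.+2) (p : 'S_n.+1) (i : 'I_n.+1) :
  (lift_perm ord_max k p ord_max < lift_perm ord_max k p (lift ord_max i))%N
    = (k <= p i)%N.
Proof.
by rewrite lift_perm_lift lift_perm_id /= /bump; case: leqP => h; lia.
Qed.

Lemma ends_with_ascent_lift (n : nat) (k : 'I_n.+2) (p : 'S_n.+1) :
  ends_with_ascent (lift_perm ord_max k p) = (p ord_max < k)%N.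
Proof.
apply/existsP/idP => [[i]|lt_pk].
  case: (unliftP ord_max i) => [j|] ->; last by rewrite ltnn andbF.
  rewrite ltn_lift_perm_last lift_max => /andP[/eqP[eq_jn]].
  by have -> : j = ord_max by apply: val_inj.
by exists (lift ord_max ord_max); rewrite ltn_lift_perm_last lift_max eqxx.
Qed.

(** The only new triple of consecutive positions is the final one; it increases exactly when [p]
    ends with an ascent and its last value is below [k]. *)
Lemma avoids_consecutive_123_lift (n : nat) (k : 'I_n.+2) (p : 'S_n.+1) :
  avoids_consecutive_123 (lift_perm ord_max k p)
    = avoids_consecutive_123 p && ~~ (ends_with_ascent p && (p ord_max < k)%N).
Proof.
apply/idP/andP => [avq|[avp end_p]].
  have av (a b c : 'I_n.+2) : b = a.+1 :> nat -> c = a.+2 :> nat ->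
      ~~ ((lift_perm ord_max k p a < lift_perm ord_max k p b)%N
          && (lift_perm ord_max k p b < lift_perm ord_max k p c)%N).
    move: avq => /forallP/(_ a)/forallP/(_ b)/forallP/(_ c)/implyP h eb ec.
    by apply: h; rewrite eb ec !eqxx.
  split.
    apply/forallP => a; apply/forallP => b; apply/forallP => c.
    apply/implyP => /andP[/eqP eb /eqP ec].
    have := av (lift ord_max a) (lift ord_max b) (lift ord_max c).
    by rewrite !lift_max !ltn_lift_perm_lift; apply.
  apply/negP => /andP[/existsP[a /andP[/eqP ea lt_a]] lt_k].
  have := av (lift ord_max a) (lift ord_max ord_max) ord_max.
  rewrite !lift_max ltn_lift_perm_lift ltn_lift_perm_last lt_a lt_k /= ea.
  by move/(_ erefl erefl).
apply/forallP => a; apply/forallP => b; apply/forallP => c.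
apply/implyP => /andP[/eqP eb /eqP ec].
case: (unliftP ord_max b) eb => [b'|] -> eb; last first.
  by have := ltn_ord c; rewrite ec -eb /= ltnn.
case: (unliftP ord_max a) eb ec => [a'|] -> eb ec; last first.
  by have := ltn_ord c; rewrite ec /= ltnNge leqW // => /negP[].
rewrite !lift_max in eb ec.
rewrite ltn_lift_perm_lift.
(* Either the triple lies inside [p], or [c] is the appended position and [a'], [b'] are the last
   two positions of [p]. *)
case: (unliftP ord_max c) ec => [c'|] -> ec.
  rewrite !lift_max in ec; rewrite ltn_lift_perm_lift.
  move/forallP/(_ a')/forallP/(_ b')/forallP/(_ c')/implyP: avp; apply.
  by rewrite eb ec !eqxx.
rewrite ltn_lift_perm_last; apply: contra end_p => /andP[lt_ab lt_bk].
have eb' : b' = ord_max by apply: val_inj => /=; rewrite eb; case: ec.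
rewrite eb' in lt_bk lt_ab; rewrite lt_bk andbT; apply/existsP; exists a'.
by rewrite lt_ab andbT; apply/eqP; case: ec.
Qed.

Lemma des_sum (n : nat) (p : 'S_n) : des p = (\sum_(i < n) (i \in descents p))%N.
Proof. by rewrite /des -sum1_card big_mkcond. Qed.

Lemma ord_max_notin_descents (n : nat) (p : 'S_n.+1) :
  (ord_max \in descents p) = false.
Proof.
rewrite inE; apply/existsP => -[j /andP[/eqP ej _]].
by have := ltn_ord j; rewrite ej ltnn.
Qed.

Lemma des_lift (n : nat) (k : 'I_n.+2) (p : 'S_n.+1) :
  des (lift_perm ord_max k p) = (des p + (k <= p ord_max))%N.
Proof.
(* A last position is never a descent, so splitting off the end terms isolates the former last
   position, the only place where a descent can be created. *)
rewrite !des_sum 3!big_ord_recr /= !ord_max_notin_descents addn0.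
have -> : widen_ord (leqnSn n.+1) ord_max = lift ord_max ord_max.
  exact/val_inj/esym/lift_max.
rewrite addn0; congr (_ + _)%N; last first.
  congr nat_of_bool; rewrite inE; apply/existsP/idP.
    case=> j; case: (unliftP ord_max j) => [j'|] -> /andP[/eqP].
      by rewrite !lift_max /= => ej; have := ltn_ord j'; rewrite ej ltnn.
    by rewrite ltn_last_lift_perm.
  by exists ord_max; rewrite ltn_last_lift_perm lift_max eqxx.
apply: eq_bigr => i _; congr nat_of_bool; rewrite !inE.
have -> : widen_ord (leqnSn n.+1) (widen_ord (leqnSn n) i)
          = lift ord_max (widen_ord (leqnSn n) i).
  exact/val_inj/esym/lift_max.
apply/existsP/existsP => -[j /andP[/eqP ej]].
  case: (unliftP ord_max j) ej => [j'|] -> ej.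
    rewrite ltn_lift_perm_lift => lt_p; exists j'; rewrite lt_p andbT.
    by move: ej; rewrite !lift_max => ->.
  by move: ej; rewrite lift_max /= => -[ej]; have := ltn_ord i; rewrite -ej ltnn.
move=> lt_p; exists (lift ord_max j).
by rewrite ltn_lift_perm_lift lt_p !lift_max ej eqxx.
Qed.

(** * Sums over avoiders refined by the last value *)

Lemma lift_perm_bij (n : nat) (i : 'I_n.+1) :
  bijective (fun js : 'I_n.+1 * 'S_n => lift_perm i js.1 js.2).
Proof.
apply: inj_card_bij => [[j s] [j' s'] /= eq_l|]; last first.
  by rewrite card_prod card_ord !card_Sn factS.
have eqj : j = j' by rewrite -(lift_perm_id i j s) eq_l lift_perm_id.
rewrite -{}eqj in eq_l *; congr (_, _); apply/permP => k.
by apply: (@lift_inj _ j); rewrite -!(lift_perm_lift i) eq_l.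
Qed.

Lemma sum_lift_perm (V : nmodType) (n : nat) (i j : 'I_n.+1)
    (P : pred 'S_n.+1) (F : 'S_n.+1 -> V) :
  \sum_(s : 'S_n.+1 | P s && (s i == j :> nat)) F s
    = \sum_(s : 'S_n | P (lift_perm i j s)) F (lift_perm i j s).
Proof.
rewrite (reindex _ (onW_bij _ (lift_perm_bij n i))) /=.
rewrite (eq_bigl (fun js => (js.1 == j) && P (lift_perm i js.1 js.2))); last first.
  by move=> js; rewrite lift_perm_id andbC.
rewrite -(pair_big_dep (pred1 j) (fun j' s => P (lift_perm i j' s))
            (fun j' s => F (lift_perm i j' s))).
by rewrite big_pred1_eq.
Qed.

Definition avoiders_sum {R : comNzRingType} (t : R) (n : nat) : R :=
  \sum_(p : 'S_n | avoids_consecutive_123 p) t ^+ (des p).+1.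

(** This is [T_n(k)]: the size is [n + 1], values start at 0, and the sum vanishes for [k > n]. *)
Definition avoiders_sum_last {R : comNzRingType} (t : R) (n k : nat) : R :=
  \sum_(p : 'S_n.+1 | avoids_consecutive_123 p && (p ord_max == k :> nat))
    t ^+ (des p).+1.

Definition non_ascent_sum_last {R : comNzRingType} (t : R) (n k : nat) : R :=
  \sum_(p : 'S_n.+1 | avoids_consecutive_123 p && ~~ ends_with_ascent p
                      && (p ord_max == k :> nat)) t ^+ (des p).+1.

Lemma sum_partition_last (V : nmodType) (n : nat) (P : pred 'S_n.+1)
    (F : 'S_n.+1 -> V) (k : nat) : (k <= n.+1)%N ->
  \sum_(p | P p && (p ord_max < k)%N) F p
    = \sum_(j < k) \sum_(p | P p && (p ord_max == j :> nat)) F p.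
Proof.
move=> le_kn.
rewrite (big_ord_widen _ (fun j => \sum_(p | P p && (p ord_max == j :> nat)) F p) le_kn).
rewrite (partition_big (fun p : 'S_n.+1 => p ord_max) (fun j => (j < k)%N)) /=;
  last first.
  by move=> p /andP[].
apply: eq_bigr => j lt_jk; apply: eq_bigl => p; rewrite -andbA; congr (_ && _).
by apply/andP/eqP => [[_ /eqP ->] //|/val_inj ->]; rewrite lt_jk eqxx.
Qed.

Lemma sum_avoiders_sum_last (R : comNzRingType) (t : R) (n : nat) :
  \sum_(k < n.+1) avoiders_sum_last t n k = avoiders_sum t n.+1.
Proof.
rewrite /avoiders_sum -sum_partition_last //.
by apply: eq_bigl => p; rewrite ltn_ord andbT.
Qed.

Lemma avoiders_sum_last0 (R : comNzRingType) (t : R) :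
  avoiders_sum_last t 0 0 = t /\ non_ascent_sum_last t 0 0 = t.
Proof.
have av (p : 'S_1) : avoids_consecutive_123 p.
  by do 3![apply/forallP => ?]; rewrite !ord1.
have asc (p : 'S_1) : ends_with_ascent p = false.
  by apply/existsP => -[i]; rewrite ord1.
have des0 (p : 'S_1) : des p = 0%N.
  by rewrite des_sum big_ord_recr big_ord0 ord_max_notin_descents.
have uniq_p (p : 'S_1) : true = (p == 1%g).
  by apply/esym/eqP/permP => i; rewrite !ord1.
split.
- rewrite /avoiders_sum_last (big_pred1 1%g); first by rewrite des0.
  by move=> p; rewrite av ord1 /= -uniq_p.
- rewrite /non_ascent_sum_last (big_pred1 1%g); first by rewrite des0.
  by move=> p; rewrite av asc ord1 /= -uniq_p.
Qed.

(** Without a final ascent, [k] is at most the former last value: any avoider may be extended, and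
    one descent is gained, whence the factor [t]. The subtracted sum removes the former last values
    below [k]. *)
Lemma non_ascent_sum_lastS (R : comNzRingType) (t : R) (n k : nat) :
  (k <= n.+1)%N ->
  non_ascent_sum_last t n.+1 k
    = t * (avoiders_sum t n.+1 - \sum_(j < k) avoiders_sum_last t n j).
Proof.
move=> le_kn; pose K := inord k : 'I_n.+2.
have eK : K = k :> nat by rewrite inordK.
rewrite /non_ascent_sum_last -{1}eK.
rewrite sum_lift_perm -sum_partition_last // /avoiders_sum.
rewrite [in RHS](bigID (fun p : 'S_n.+1 => (p ord_max < k)%N)) /= addrC addrK big_distrr.
apply: eq_big => [p|p].
  rewrite avoids_consecutive_123_lift ends_with_ascent_lift eK.
  by case: (_ < _)%N; rewrite ?andbF ?andbT.
rewrite ends_with_ascent_lift des_lift -leqNgt eK => /andP[_ ->].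
by rewrite addn1; apply: exprS.
Qed.

(** When the final step is an ascent, the shorter avoider must not itself end with one, its last
    value is below [k], and no descent is gained. *)
Lemma avoiders_sum_lastS (R : comNzRingType) (t : R) (n k : nat) :
  (k <= n.+1)%N ->
  avoiders_sum_last t n.+1 k
    = non_ascent_sum_last t n.+1 k + \sum_(j < k) non_ascent_sum_last t n j.
Proof.
move=> le_kn; pose K := inord k : 'I_n.+2.
have eK : K = k :> nat by rewrite inordK.
rewrite -sum_partition_last // /avoiders_sum_last.
rewrite (bigID (fun p => ends_with_ascent p)) /= addrC; congr (_ + _).
  by apply: eq_bigl => p; rewrite andbAC.
under eq_bigl => p do rewrite andbAC -{1}eK.
rewrite sum_lift_perm; apply: eq_big => [p|p].
  rewrite avoids_consecutive_123_lift ends_with_ascent_lift eK.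
  by case: (_ < _)%N; rewrite ?andbF ?andbT.
by rewrite ends_with_ascent_lift des_lift ltnNge eK => /andP[_ /negbTE->]; rewrite addn0.
Qed.

(** * Solving the recurrences in the binomial basis *)

Lemma sum_bin (n m : nat) : (\sum_(i < n) 'C(i, m) = 'C(n, m.+1))%N.
Proof.
by elim: n => [|n IHn]; rewrite ?big_ord0 ?bin0n // big_ord_recr /= IHn binS.
Qed.

Lemma sum_bin_combination (R : comNzRingType) (d : nat -> R) (n k : nat) :
  \sum_(i < k) \sum_(j < n) d j * 'C(i, j)%:R = \sum_(j < n) d j * 'C(k, j.+1)%:R.
Proof.
rewrite exchange_big; apply: eq_bigr => j _.
by rewrite -big_distrr -natr_sum sum_bin.
Qed.

(** The empty permutation has to count for 1, whereas [avoiders_sum t 0] is [t]. *)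
Definition avoiders_seq {R : comNzRingType} (t : R) (n : nat) : R :=
  if n is 0 then 1 else avoiders_sum t n.

(** The two closed forms are proved together because the recurrence of each family calls on the
    other. *)
Lemma last_sums_closed (R : comNzRingType) (t : R) (c : nat -> R) :
  c 0 = 1 -> c 1 = - t -> (forall n, c n.+2 = - t * (c n.+1 + c n)) ->
  forall n i, (i <= n)%N ->
    avoiders_sum_last t n i
      = - (\sum_(j < n.+1) c j.+1 * avoiders_seq t (n - j) * 'C(i, j)%:R)
    /\ non_ascent_sum_last t n i
      = t * (\sum_(j < n.+1) c j * avoiders_seq t (n - j) * 'C(i, j)%:R).
Proof.
move=> c0 c1 cS; elim=> [|n IHn] i le_in.
  move: le_in; rewrite leqn0 => /eqP ->; have [-> ->] := avoiders_sum_last0 R t.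
  by rewrite !big_ord1 c0 c1 /= !mulr1 opprK.
(* The term [j = 0] is [a_{n+1}]; prefix sums of [T_n] give the others, with the binomial index
   shifted by one. *)
have D_eq : non_ascent_sum_last t n.+1 i
    = t * (\sum_(j < n.+2) c j * avoiders_seq t (n.+1 - j) * 'C(i, j)%:R).
  rewrite non_ascent_sum_lastS // big_ord_recl c0 bin0 mul1r mulr1; congr (_ * (_ + _)).
  rewrite -(sum_bin_combination _ (fun j => c j.+1 * avoiders_seq t (n - j))) -sumrN.
  apply: eq_bigr => j _; rewrite (IHn j _).1 ?opprK //.
  by rewrite -ltnS (leq_trans (ltn_ord j)).
split=> //; rewrite avoiders_sum_lastS // D_eq.
rewrite (eq_bigr (fun j : 'I_i => \sum_(k < n.+1)
   (t * (c k * avoiders_seq t (n - k))) * 'C(j, k)%:R)); last first.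
  move=> j _; rewrite (IHn j _).2; last by rewrite -ltnS (leq_trans (ltn_ord j)).
  by rewrite big_distrr; apply: eq_bigr => k _; rewrite /= !mulrA.
rewrite (sum_bin_combination _ (fun k => t * (c k * avoiders_seq t (n - k)))).
(* Coefficients of ['C(i, j)] are compared: [j = 0] uses [c 1 = - t], and [j > 0] the recurrence of
   [c]. *)
rewrite big_ord_recl [in RHS]big_ord_recl c0 c1 bin0 mulrDr -addrA opprD.
congr (_ + _); first by rewrite mul1r !mulr1 mulNr opprK.
rewrite big_distrr -big_split -sumrN; apply: eq_bigr => j _ /=.
by rewrite /bump /= add1n subSS cS; ring.
Qed.

(** The term [j = 0] is [a_{n+1}], the sum of [T_n] over all last values; its closed form cancels
    the remaining terms. *)
Lemma avoiders_seq_convolution (R : comNzRingType) (t : R) (c : nat -> R) (n : nat) :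
  c 0 = 1 -> c 1 = - t -> (forall m, c m.+2 = - t * (c m.+1 + c m)) ->
  \sum_(j < n.+2) c j * avoiders_seq t (n.+1 - j) * 'C(n.+1, j)%:R = 0.
Proof.
move=> c0 c1 cS; rewrite big_ord_recl c0 bin0 mul1r mulr1 /= -sum_avoiders_sum_last.
rewrite (eq_bigr (fun i : 'I_n.+1 =>
  - \sum_(j < n.+1) c j.+1 * avoiders_seq t (n - j) * 'C(i, j)%:R)); last first.
  by move=> i _; rewrite (last_sums_closed _ _ _ c0 c1 cS n i (ltn_ord i)).1.
rewrite sumrN (sum_bin_combination _ (fun j => c j.+1 * avoiders_seq t (n - j))).
by rewrite addNr.
Qed.

(** * Exponential generating functions *)

Lemma fps_unitE (K : fieldType) (f : fps K) :
  (f \is a GRing.unit) = (fpscoef f 0 != 0).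
Proof. by []. Qed.

Lemma coef_fps_constM (K : fieldType) (a : K) (f : fps K) (n : nat) :
  fpscoef (fps_const a * f) n = a * fpscoef f n.
Proof.
rewrite /= big_ord_recl subn0 big1 ?addr0 // => i _.
by rewrite /= mul0r.
Qed.

Lemma fps_constM (K : fieldType) (a b : K) :
  fps_const a * fps_const b = fps_const (a * b).
Proof. by apply/fpsP => -[|n]; rewrite coef_fps_constM //= mulr0. Qed.

Lemma egf_mul (K : fieldType) (f g : nat -> K) :
  (forall n, n.+1%:R != 0 :> K) ->
  egf f * egf g = egf (fun n => \sum_(j < n.+1) f j * g (n - j)%N * 'C(n, j)%:R).
Proof.
move=> char0; have nat_neq0 n : (0 < n)%N -> n%:R != 0 :> K by case: n.
apply/fpsP => n /=; rewrite big_distrl; apply: eq_bigr => j _ /=.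
have le_jn : (j <= n)%N by rewrite -ltnS.
rewrite -(bin_fact le_jn) !natrM; field.
by rewrite !nat_neq0 ?fact_gt0 ?bin_gt0.
Qed.

Lemma fps_expD (K : fieldType) (a b : K) :
  (forall n, n.+1%:R != 0 :> K) -> fps_exp a * fps_exp b = fps_exp (a + b).
Proof.
move=> char0; rewrite (egf_mul _ (fun n => a ^+ n) (fun n => b ^+ n)) //.
apply/fpsP => n /=; congr (_ / _); rewrite addrC exprDn.
by apply: eq_bigr => j _; rewrite mulr_natr [a ^+ j * _]mulrC.
Qed.

Lemma egf_avoiders_inverse (K : fieldType) (t : K) (c : nat -> K) :
  (forall n, n.+1%:R != 0 :> K) ->
  c 0 = 1 -> c 1 = - t -> (forall m, c m.+2 = - t * (c m.+1 + c m)) ->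
  egf c * egf (avoiders_seq t) = 1.
Proof.
move=> char0 c0 c1 cS; rewrite egf_mul //; apply/fpsP => -[|n] /=.
  by rewrite big_ord1 c0 bin0 !mulr1 divr1.
by rewrite avoiders_seq_convolution // mul0r.
Qed.

Lemma egf_avoiders_seq (K : fieldType) (t u v w : K) :
  (forall n, n.+1%:R != 0 :> K) -> v != 0 ->
  u ^+ 2 = t -> v ^+ 2 = t - 4%:R -> w = u * v ->
  let denominator := fps_const v * fps_cosh (w / 2%:R)
                     - fps_const u * fps_sinh (w / 2%:R) in
  egf (avoiders_seq t) = fps_exp (t / 2%:R) * fps_const v / denominator.
Proof.
move=> char0 v_neq0 ut vt wE den.
have two_neq0 : 2%:R != 0 :> K := char0 1%N.
pose h := w / 2%:R; pose r := - (t / 2%:R).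
(* These weights solve [alpha + beta = 1] and [r + (alpha - beta) * h = - t], the initial conditions
   [c 0] and [c 1]. *)
pose alpha : K := (1 - u / v) / 2%:R; pose beta : K := (1 + u / v) / 2%:R.
pose c n : K := alpha * (r + h) ^+ n + beta * (r - h) ^+ n.
have h2 : h ^+ 2 = (t ^+ 2 - 4%:R * t) / 4%:R.
  rewrite /h expr_div_n wE exprMn ut vt.
  by field; exact: (char0 3%N).
have c0 : c 0 = 1 by rewrite /c /alpha /beta; field; rewrite v_neq0 two_neq0.
have c1 : c 1 = - t.
  by rewrite /c /alpha /beta /r /h wE -ut; field; rewrite v_neq0 two_neq0.
(* Both [r + h] and [r - h] are roots of [z^2 + t z + t], so their powers obey the recurrence of
   [c]. *)
have root_c x : x ^+ 2 = h ^+ 2 -> (r + x) ^+ 2 = - t * ((r + x) + 1).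
  by move=> xh; rewrite sqrrD xh h2 /r; field; rewrite two_neq0 (char0 3%N).
have cS m : c m.+2 = - t * (c m.+1 + c m).
  have e1 := root_c h erefl.
  have e2 := root_c (- h) (sqrrN h).
  rewrite /c -[m.+2]addn2 -[m.+1]addn1 !exprD e1 e2 !expr1; ring.
have inv := egf_avoiders_inverse _ t c char0 c0 c1 cS.
have egf_c : egf c = fps_const alpha * fps_exp (r + h)
                     + fps_const beta * fps_exp (r - h).
  apply/fpsP => n; rewrite [RHS](_ : _ = fpscoef (fps_const alpha * fps_exp (r + h)) n
    + fpscoef (fps_const beta * fps_exp (r - h)) n) // !coef_fps_constM /=.
  by rewrite mulrDl !mulrA.
(* The factor [fps_exp (t / 2)] cancels the common shift [r], leaving exponentials of [h] and [- h]
   with weights [(v - u) / 2] and [(v + u) / 2]. *)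
have denE : den = fps_exp (t / 2%:R) * fps_const v * egf c.
  have e1 : fps_exp (t / 2%:R) * fps_exp (r + h) = fps_exp h.
    by rewrite fps_expD // addrA subrr add0r.
  have e2 : fps_exp (t / 2%:R) * fps_exp (r - h) = fps_exp (- h).
    by rewrite fps_expD // addrA subrr add0r.
  transitivity (fps_const (v * alpha) * fps_exp h
                + fps_const (v * beta) * fps_exp (- h)); last first.
    by rewrite -e1 -e2 egf_c -!fps_constM; ring.
  have coefD (f g : fps K) n : fpscoef (f + g) n = fpscoef f n + fpscoef g n by [].
  have coefN (f : fps K) n : fpscoef (- f) n = - fpscoef f n by [].
  apply/fpsP => n; rewrite /den /fps_cosh /fps_sinh !(coefD, coefN, coef_fps_constM).
  rewrite /alpha /beta -/h; field; by rewrite v_neq0 two_neq0.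
(* The constant term is [v], so the quotient in the statement is a genuine one. *)
have den_unit : den \is a GRing.unit.
  rewrite denE !unitrM !fps_unitE /= c0 divr1 expr0 v_neq0.
  by rewrite oner_eq0.
apply: (mulIr den_unit); rewrite mulrVK // denE.
by rewrite mulrCA [egf _ * egf _]mulrC inv mulr1.
Qed.

Lemma egf_avoiders_seqE (K : fieldType) (t : K) :
  1 + egf (fun n => if n == 0 then 0 else avoiders_sum t n) = egf (avoiders_seq t).
Proof.
by apply/fpsP => -[|n] /=; rewrite ?mul0r ?addr0 ?divr1 ?add0r.
Qed.

(** Dividing by [t] lowers the exponent for [n > 0]; at [n = 0] it yields [t^-1], which the last two
    terms correct to 1. *)
Lemma egf_avoiders_des (K : fieldType) (t : K) : t != 0 ->
  egf (fun n => \sum_(p : 'S_n | avoids_consecutive_123 p) t ^+ des p)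
    = fps_const t^-1 * egf (avoiders_seq t) - fps_const t^-1 + 1.
Proof.
move=> t_neq0.
have coefD (f g : fps K) n : fpscoef (f + g) n = fpscoef f n + fpscoef g n by [].
have coefN (f : fps K) n : fpscoef (- f) n = - fpscoef f n by [].
apply/fpsP => -[|n]; rewrite !(coefD, coefN, coef_fps_constM) /=.
  rewrite (big_pred1 1%g) => [|p].
    rewrite /des eq_card0 => [|i]; last by case: i.
    by rewrite !divr1 mulr1 subrr add0r.
  apply/esym; rewrite -[RHS]/(avoids_consecutive_123 p).
  have -> : avoids_consecutive_123 p by apply/forallP => -[].
  by apply/eqP/permP => -[].
rewrite subr0 addr0 mulrA big_distrr; congr (_ / _).
by apply: eq_bigr => p _; rewrite /= exprS mulKf.
Qed.

Theorem theorem4p1 (K : fieldType)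
    (iota : {rmorphism {fraction {poly rat}} -> K})
    (sqrt_t sqrt_t4 sqrt_t2m4t : K) :
  let t : K := iota (@FracField.tofrac {poly rat} 'X) in
  sqrt_t ^+ 2 = t ->
  sqrt_t4 ^+ 2 = t - 4%:R ->
  sqrt_t2m4t ^+ 2 = t ^+ 2 - 4%:R * t ->
  sqrt_t2m4t = sqrt_t * sqrt_t4 ->
  let denominator : fps K :=
    fps_const sqrt_t4 * fps_cosh (sqrt_t2m4t / 2%:R)
    - fps_const sqrt_t * fps_sinh (sqrt_t2m4t / 2%:R) in
  1 + egf (fun n => if n == 0%N then 0 else
             \sum_(p : 'S_n | avoids_consecutive_123 p) t ^+ (des p).+1)
    = fps_exp (t / 2%:R) * fps_const sqrt_t4 / denominator
  /\
  egf (fun n => \sum_(p : 'S_n | avoids_consecutive_123 p) t ^+ des p)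
    = fps_const t^-1 * fps_exp (t / 2%:R) * fps_const sqrt_t4 / denominator
      - fps_const t^-1 + 1.
Proof.
move=> t ut vt _ wE denominator.
have natK n : n%:R = iota (@FracField.tofrac {poly rat} n%:R) :> K.
  by rewrite !rmorph_nat.
(* [K] inherits characteristic zero through the injective [iota]. *)
have char0 n : n.+1%:R != 0 :> K.
  by rewrite natK fmorph_eq0 tofrac_eq0 -polyC_natr polyC_eq0 Num.Theory.pnatr_eq0.
have t_neq0 : t != 0 by rewrite fmorph_eq0 tofrac_eq0 polyX_eq0.
(* Its square is the image of the nonzero polynomial ['X - 4]. *)
have v_neq0 : sqrt_t4 != 0.
  rewrite -sqrf_eq0 vt natK /t -!rmorphB fmorph_eq0 tofrac_eq0 -polyC_natr.
  by rewrite polyXsubC_eq0.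
have egfE := egf_avoiders_seq K t _ _ _ char0 v_neq0 ut vt wE.
split; first by rewrite -egfE -egf_avoiders_seqE.
by rewrite egf_avoiders_des // egfE -/denominator !mulrA.
Qed.
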